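(* For each positive integer $M$ let $F_M$ be a real $M\times N_M$ frame, let $C>1$, and let $\{p_M\}_{M=1}^\infty\subseteq[0,1]$ be a sequence of erasure rates, with each $(1-p_M)N_M$ an integer, such that $$\liminf_{M\rightarrow\infty}p_M>1-2Q(C),\qquad Q(t):=\frac{1}{\sqrt{2\pi}}\int_t^\infty e^{-u^2/2}\,du.$$ Then for all sufficiently large $M$, $F_M$ is not a $(p_M,C)$-numerically erasure-robust frame.
   Context: A real $M\times N$ frame is a real $M\times N$ matrix whose columns span $\mathbb{R}^M$. For an $M\times K$ matrix $A$, $\mathrm{Cond}(A)$ is the ratio of its greatest singular value to its smallest one, i.e. $\mathrm{Cond}(A)=\sqrt{\lambda_{\max}(AA^* )/\lambda_{\min}(AA^* )}$ where $AA^*$ is $M\times M$, with $\mathrm{Cond}(A)=\infty$ if $A$ has rank less than $M$ (including $K=0$). For $\mathcal{K}\subseteq\{1,\dots,N\}$, $F_{\mathcal{K}}$ is the submatrix of $F$ formed by the columns indexed by $\mathcal{K}$. Given $p\in[0,1]$ (with $(1-p)N$ an integer) and $C\ge1$, an $M\times N$ frame $F$ is a $(p,C)$-numerically erasure-robust frame if $\mathrm{Cond}(F_{\mathcal{K}})\le C$ for every $\mathcal{K}\subseteq\{1,\dots,N\}$ of size $(1-p)N$. *)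

(* Defs.v *)
From HB Require Import structures.
From mathcomp Require Import all_boot all_order all_algebra.
From mathcomp Require Import all_classical all_reals all_analysis.
Set Implicit Arguments.
Unset Strict Implicit.
Unset Printing Implicit Defensive.
Import Order.TTheory GRing.Theory Num.Theory.
Import numFieldNormedType.Exports.
Local Open Scope classical_set_scope.
Local Open Scope ring_scope.

Definition is_frame (R : realType) (M N : nat) (F : 'M[R]_(M, N)) : bool :=
  row_full F^T.

(* [A *m A^T] is symmetric: for [0 < M] its real spectrum is finite and
   nonempty, so this [sup] is a maximum and the [inf] below a minimum. *)
Definition lambda_max (R : realType) (M : nat) (S : 'M[R]_M) : R :=
  sup [set a | eigenvalue S a].

Definition lambda_min (R : realType) (M : nat) (S : 'M[R]_M) : R :=
  inf [set a | eigenvalue S a].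

Definition Cond (R : realType) (M K : nat) (A : 'M[R]_(M, K)) : \bar R :=
  if (\rank A < M)%N then +oo%E
  else (Num.sqrt (lambda_max (A *m A^T) / lambda_min (A *m A^T)))%:E.

Definition col_restrict (R : realType) (M N : nat) (F : 'M[R]_(M, N))
    (K : {set 'I_N}) : 'M[R]_(M, #|K|) :=
  colsub (fun j : 'I_#|K| => enum_val j) F.

(* The standing conditions on [p], [C] and [F] ([F] is a frame, [0 <= p <= 1],
   [(1 - p) * N] is an integer, [1 <= C]) are left to the context of use. *)
Definition is_NERF (R : realType) (M N : nat) (p C : R) (F : 'M[R]_(M, N)) :
    Prop :=
  forall K : {set 'I_N}, #|K|%:R = (1 - p) * N%:R :> R ->
    (Cond (col_restrict F K) <= C%:E)%E.

Definition Q (R : realType) (t : R) : R :=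
  (Num.sqrt (2 * pi))^-1 *
  \int[lebesgue_measure]_(u in `[t, +oo[) expR (- (u ^+ 2 / 2)).

(* Main.v *)
Require Import Defs.
From HB Require Import structures.
From mathcomp Require Import all_boot all_order all_algebra.
From mathcomp Require Import all_classical all_reals all_analysis.
From mathcomp Require Import ring lra.
Set Implicit Arguments.
Unset Strict Implicit.
Unset Printing Implicit Defensive.
Import Order.TTheory GRing.Theory Num.Theory.
Import numFieldNormedType.Exports.
Local Open Scope classical_set_scope.
Local Open Scope ring_scope.

(** Why the theorem is true.  Let [v n] be the direction of the [n]-th column of
    an [M]-rowed matrix [F], and let [x] have squared norm [M].  If
    [C < |<x, v n>|] for every [n] in [K], then [Cond] exceeds [C] on [F_K]: the
    greatest eigenvalue of [F_K F_K^T] is at least its Rayleigh quotient at [x],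
    which is more than [C^2] times the mean of the eigenvalues, [tr / M], and the
    least eigenvalue is at most that mean ([Cond_col_restrict_gt]).  It is thus
    enough to find [x] for which at least [(1 - p_M) N_M] indices satisfy
    [C < |<x, v n>|].

    If [x] is uniformly distributed on the sphere of radius [sqrt M], each
    [<x, v n>] is almost a standard Gaussian variable, so a proportion close to
    [2 Q(C)] of the indices qualifies on average.  The proof replaces this
    average by a minimisation.  For [c < 2 Q(C)], Stein's equation
    for the Gaussian law yields a compactly supported [f] with
    [f' s - s f s <= 1_(C < |s|) - c] ([stein_test_function]).  If [psi' = f],
    then [f' s - s f s], at [s = <x, v>], is up to [O(1 / M)] the Laplacian on
    the sphere of radius [sqrt M] of the function [x |-> psi <x, v>].  At a
    point [x] of the sphere where [\sum_n psi <x, v n>] is least, the Laplacian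
    of that sum is nonnegative, by the second derivative test along plane
    rotations ([sphere_laplacian]).  Summing the Stein inequality over [n] gives
    at least [(c - O(1 / M)) N] indices with [C < |<x, v n>|], where the
    error does not depend on the vectors ([sphere_large_dot]). *)

(** * Real functions of one variable *)

Lemma is_derive_continuous (R : realType) (f : R -> R) (x df : R) :
  is_derive x 1 f df -> {for x, continuous f}.
Proof. by move=> [fx _]; exact/differentiable_continuous/derivable1_diffP. Qed.

Lemma mean_value (R : realType) (f df : R -> R) (a b : R) : a < b ->
  (forall x : R, is_derive x 1 f (df x)) ->
  exists2 c, a < c < b & f b - f a = df c * (b - a).
Proof.
move=> ab fdf; have [|c cab ->] := MVT ab (fun x _ => fdf x).
  by apply: continuous_subspaceT => x; exact: is_derive_continuous (fdf x).
by exists c.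
Qed.

(** If [d < 0], then [df] is negative just to the right of its zero [x], and
    the mean value theorem puts a value of [f] below [f x]. *)
Lemma second_derivative_test (R : realType) (f df : R -> R) (x d : R) :
  (forall y : R, is_derive y 1 f (df y)) -> is_derive x 1 df d ->
  (forall y, f x <= f y) -> 0 <= d.
Proof.
move=> fdf dfd fmin; rewrite leNgt; apply/negP => d0.
have dfx : df x = 0.
  have xI : x \in `](x - 1), (x + 1)[%R by rewrite in_itv/=; apply/andP; lra.
  have fx0 : is_derive x 1 f 0.
    have x11 : x - 1 <= x + 1 by lra.
    by apply: derive1_at_min x11 _ xI _ => // t _; case: (fdf t).
  by case: (fdf x) => _ <-; case: fx0.
have [h [dfh ch hx]] := (is_derive1_caratheodory df x d).1 dfd.
have [e /= e0 he] : \forall y \near x, h y < 0.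
  by apply: (cvgr_lt _ ch); rewrite hx.
have [|c /andP[xc cx]] := @mean_value _ f df x (x + e / 2) _ fdf.
  by rewrite ltrDl divr_gt0.
have hc : h c < 0 by apply: he; rewrite /ball/= ltr_distlC; apply/andP; lra.
have := dfh c; rewrite dfx subr0 => -> fE.
have := fmin (x + e / 2); rewrite -subr_ge0 fE leNgt => /negP; apply.
by rewrite pmulr_llt0 ?nmulr_rlt0//; lra.
Qed.

Lemma is_derive_quadratic (R : realType) (f : R -> R) (x a : R) :
  (forall y, `|f y - f x - a * (y - x)| <= (y - x) ^+ 2) -> is_derive x 1 f a.
Proof.
move=> fa; apply/is_derive1_caratheodory.
exists (fun y => if y == x then a else (f y - f x) / (y - x)); split; last first.
- by rewrite eqxx.
- apply/cvgrPdist_le => e e0 /=; rewrite eqxx; near=> y.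
  case: eqP => [_|/eqP yx]; first by rewrite subrr normr0 ltW.
  have yx0 : y - x != 0 by rewrite subr_eq0.
  have yxe : `|y - x| <= e by rewrite distrC; near: y; exact: cvgr_dist_le.
  apply: le_trans yxe.
  have -> : a - (f y - f x) / (y - x) = - ((f y - f x - a * (y - x)) / (y - x)).
    by field.
  rewrite normrN normrM normfV ler_pdivrMr ?normr_gt0//.
  by rewrite -normrM -expr2 normrX real_normK ?num_real// fa.
- move=> y; case: eqP => [->|/eqP yx]; first by rewrite !subrr mulr0.
  by rewrite divfK// subr_eq0.
Unshelve. all: by end_near. Qed.

(** Combinations of translates of this C^1 function, whose derivative has a
    corner, round off the corners of piecewise affine functions. *)
Lemma is_derive_sqr_max0 (R : realType) (x : R) :
  is_derive x 1 (fun y : R => Num.max y 0 ^+ 2) (2 * Num.max x 0).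
Proof.
apply: is_derive_quadratic => y; rewrite ler_norml.
have := sqr_ge0 (y - x); have := sqr_ge0 y; have := sqr_ge0 x; rewrite !expr2 => xx yy yx.
case: (leP x 0) => x0; case: (leP y 0) => y0; apply/andP.
- by split; nra.
- by have xy := mulr_le0_ge0 x0 (ltW y0); split; nra.
- by have xy := mulr_ge0_le0 (ltW x0) y0; split; nra.
- by split; nra.
Qed.

Lemma is_derive_integralNy (R : realType) (f : R -> R) (x : R) :
  continuous f -> (@lebesgue_measure R).-integrable setT (EFin \o f) ->
  is_derive x 1 (fun y => \int[lebesgue_measure]_(t in `]-oo, y]) f t) (f x).
Proof.
move=> cf intf.
have xx : x < x + 1 by rewrite ltrDl.
have intfx : (@lebesgue_measure R).-integrable
    [set` Interval -oo%O (BRight (x + 1))] (EFin \o f).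
  exact: integrableS intf.
have [] := continuous_FTC1 xx intfx (ltNyr _) (cf x).
by rewrite derive1E => dF <-; exact/derivableP.
Qed.

(** * The standard Gaussian law *)

Definition gauss_pdf (R : realType) (x : R) : R :=
  (Num.sqrt (2 * pi))^-1 * expR (- (x ^+ 2 / 2)).

Lemma normal_pdf01 (R : realType) : normal_pdf 0 1 = @gauss_pdf R.
Proof.
apply/funext => x; rewrite normal_pdfE ?oner_neq0// /normal_peak /normal_fun.
rewrite /gauss_pdf subr0 !expr1n mul1r.
by rewrite -(mulr_natl pi) mulNr.
Qed.

Lemma gauss_pdf_gt0 (R : realType) (x : R) : 0 < gauss_pdf x.
Proof. by rewrite mulr_gt0 ?expR_gt0// invr_gt0 sqrtr_gt0 mulr_gt0// pi_gt0. Qed.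

Lemma gauss_pdfN (R : realType) (x : R) : gauss_pdf (- x) = gauss_pdf x.
Proof. by rewrite /gauss_pdf sqrrN. Qed.

Lemma is_derive_gauss_pdf (R : realType) (x : R) :
  is_derive x 1 (@gauss_pdf R) (- x * gauss_pdf x).
Proof.
pose h := fun y : R => - (y ^+ 2 / 2).
have hx : is_derive x 1 h (- x).
  by apply: is_derive_eq; rewrite /GRing.scale/=; field.
have ex : is_derive x 1 (expR \o h) (expR (h x) * - x).
  exact: is_derive1_comp.
have -> : @gauss_pdf R = (Num.sqrt (2 * pi))^-1 \*: (expR \o h) by [].
by apply: is_derive_eq; rewrite /= /gauss_pdf /h /GRing.scale/=; ring.
Qed.

Lemma continuous_gauss_pdf (R : realType) : continuous (@gauss_pdf R).
Proof. by rewrite -normal_pdf01; apply: continuous_normal_pdf; exact: oner_neq0. Qed.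

Lemma integrable_gauss_pdf (R : realType) (A : set R) : measurable A ->
  (@lebesgue_measure R).-integrable A (EFin \o @gauss_pdf R).
Proof.
move=> mA; rewrite -normal_pdf01.
by apply: integrableS (integrable_normal_pdf _ _).
Qed.

Definition gauss_cdf (R : realType) (x : R) : R :=
  \int[lebesgue_measure]_(t in `]-oo, x]) gauss_pdf t.

Lemma gauss_tail (R : realType) (x : R) :
  \int[lebesgue_measure]_(t in `[x, +oo[) gauss_pdf t = 1 - gauss_cdf x.
Proof.
rewrite -Rintegral_itv_obnd_cbnd; last exact: integrable_gauss_pdf.
rewrite -(@Rintegral_itvB _ _ -oo%O +oo%O)//; last exact: integrable_gauss_pdf.
congr (_ - _).
by rewrite set_itvE -normal_pdf01 /Rintegral integral_normal_pdf.
Qed.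

Lemma Q_gauss_cdf (R : realType) (x : R) : Q x = 1 - gauss_cdf x.
Proof.
rewrite -gauss_tail /Q /gauss_pdf RintegralZl//.
have : (@lebesgue_measure R).-integrable `[x, +oo[
   (fun t => (Num.sqrt (2 * pi))%:E * (gauss_pdf t)%:E)%E.
  by apply: integrableZl => //; exact: integrable_gauss_pdf.
apply: eq_integrable => // t _.
by rewrite -EFinM /gauss_pdf mulVKf// gt_eqF// sqrtr_gt0 mulr_gt0// pi_gt0.
Qed.

Lemma gauss_cdfN (R : realType) (x : R) : gauss_cdf (- x) = 1 - gauss_cdf x.
Proof.
rewrite -gauss_tail {1}/gauss_cdf /Rintegral.
rewrite (@ge0_integration_by_substitutionNy R (@gauss_pdf R) x).
- by congr fine; apply: eq_integral => t _ /=; rewrite gauss_pdfN.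
- by apply: continuous_subspaceT; exact: continuous_gauss_pdf.
- by move=> t _; exact/ltW/gauss_pdf_gt0.
Qed.

Lemma is_derive_gauss_cdf (R : realType) (x : R) :
  is_derive x 1 (@gauss_cdf R) (gauss_pdf x).
Proof.
by apply: is_derive_integralNy; [exact: continuous_gauss_pdf|
  exact: integrable_gauss_pdf].
Qed.

(** The normal probability of [`]-oo, n]] tends to that of the whole line. *)
Lemma gauss_cdf_sup (R : realType) (y : R) :
  y < 1 -> exists x : R, y < gauss_cdf x.
Proof.
move=> y1.
pose P : probability _ R := normal_prob 0 1.
pose F (n : nat) : set R := `]-oo, n%:R]%classic.
have FT : \bigcup_n F n = setT.
  rewrite -subTset => t _; exists (Num.truncn t).+1 => //.
  by rewrite /F /= in_itv/= ltW// truncnS_gt.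
have : P \o F @ \oo --> P (\bigcup_n F n).
  apply: nondecreasing_cvg_mu => [n||]; [exact: measurable_itv|by rewrite FT|].
  move=> m n mn; apply/subsetPset; apply: subset_itvl.
  by rewrite bnd_simp ler_nat.
rewrite FT probability_setT => cvgPF.
have [n _ /(_ n (leqnn n))] : \forall n \near \oo, (y%:E < P (F n))%E.
  by apply: (cvgPF [set z | (y%:E < z)%E]); apply: open_ereal_gt'; rewrite lte_fin.
exists n%:R.
rewrite -lte_fin /gauss_cdf /Rintegral fineK.
  by rewrite -normal_pdf01.
by apply: integrable_fin_num => //; exact: integrable_gauss_pdf.
Qed.

(** * A solution of the Stein inequality *)

(** The primitive of [ramp] that vanishes on the negative half-line: the positive
    part of [x - e / 2] with its corner rounded off on [`[0, e]]. *)
Definition smooth_ramp (R : realType) (e x : R) : R :=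
  (Num.max x 0 ^+ 2 - Num.max (x - e) 0 ^+ 2) / (2 * e).

Definition ramp (R : realType) (e x : R) : R :=
  (Num.max x 0 - Num.max (x - e) 0) / e.

Lemma is_derive_smooth_ramp (R : realType) (e x : R) : 0 < e ->
  is_derive x 1 (smooth_ramp e) (ramp e x).
Proof.
move=> e0; have d1 := @is_derive_sqr_max0 R x.
have d2 : is_derive x 1 ((fun y : R => Num.max y 0 ^+ 2) \o (fun y : R => y - e))
    (2 * Num.max (x - e) 0 * 1).
  apply: is_derive1_comp; first exact: is_derive_sqr_max0.
  by apply: is_derive_eq; rewrite subr0.
have -> : smooth_ramp e = (2 * e)^-1 \*: ((fun y : R => Num.max y 0 ^+ 2) -
    ((fun y : R => Num.max y 0 ^+ 2) \o (fun y : R => y - e))).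
  by apply/funext => y; rewrite /smooth_ramp /= mulrC.
apply: is_derive_eq; rewrite /ramp /GRing.scale/=; field.
by rewrite gt_eqF.
Qed.

Lemma ramp_le0 (R : realType) (e x : R) : 0 < e -> x <= 0 -> ramp e x = 0.
Proof.
by move=> e0 x0; rewrite /ramp !max_r ?subrr ?mul0r//; lra.
Qed.

Lemma smooth_ramp_le0 (R : realType) (e x : R) : 0 < e -> x <= 0 ->
  smooth_ramp e x = 0.
Proof.
by move=> e0 x0; rewrite /smooth_ramp !max_r ?subrr ?mul0r//; lra.
Qed.

Lemma ramp_ge (R : realType) (e x : R) : 0 < e -> e <= x -> ramp e x = 1.
Proof.
move=> e0 x0; rewrite /ramp !max_l; [|lra..].
by field; rewrite gt_eqF.
Qed.

Lemma smooth_ramp_ge (R : realType) (e x : R) : 0 < e -> e <= x ->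
  smooth_ramp e x = x - e / 2.
Proof.
move=> e0 x0; rewrite /smooth_ramp !max_l; [|lra..].
by field; rewrite gt_eqF.
Qed.

Lemma ramp_itv (R : realType) (e x : R) : 0 < e -> 0 <= ramp e x <= 1.
Proof.
move=> e0; rewrite /ramp ler_pdivlMr// ler_pdivrMr// mul0r mul1r.
by case: (leP x 0) => ?; case: (leP (x - e) 0) => ?; apply/andP; lra.
Qed.

(** The Stein function is sought in the form [s |-> - chi (W s) / gauss_pdf s],
    where [W] is a primitive of [gauss_pdf] with values in [`]-L, L[] for
    [L = 1 / 2] and [W C = v1]; the Stein inequality then becomes the bounds on
    [dchi] stated here.  An odd [chi] that has slope [c] up to [v1] and then
    slope [c - 1] comes back to [0] at [v1 / (1 - c)], which is less than [L]
    precisely when [c] is less than the Gaussian mass [1 - v1 / L] beyond [C].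
    The room left there allows rounding the corners. *)
Lemma hat_profile (R : realType) (c v1 L : R) :
  0 <= c < 1 -> 0 < v1 -> v1 < (1 - c) * L ->
  exists chi dchi : R -> R, exists2 v2, v2 < L &
  forall v : R, [/\ is_derive v 1 chi (dchi v),
    `|v| <= v1 -> dchi v = c, c - 1 <= dchi v <= 1 &
    v2 <= `|v| -> chi v = 0 /\ dchi v = 0].
Proof.
move=> /andP[c0 c1] v10 v1L; set e := ((1 - c) * L - v1) / 2.
have e0 : 0 < e by rewrite /e; lra.
have c1' : 0 < 1 - c by lra.
(* The equation [aE] on [a], the start of the second rounded corner, makes the
   descending branch reach [0] with slope [0] at [a + e]. *)
pose a := (v1 + e / 2) / (1 - c) - e / 2.
have aE : (1 - c) * (a + e / 2) = v1 + e / 2.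
  by rewrite /a subrK mulrC divfK// gt_eqF.
have v1a : v1 <= a by nra.
have aeL : a + e < L.
  rewrite -(ltr_pM2l c1'); have -> : (1 - c) * (a + e) =
    (1 - c) * (a + e / 2) + (1 - c) * (e / 2) by field.
  rewrite aE; have : (1 - c) * e <= e by nra.
  by rewrite /e; lra.
pose tau v := smooth_ramp e (v - v1) - (1 - c) * smooth_ramp e (v - a).
pose dtau v := ramp e (v - v1) - (1 - c) * ramp e (v - a).
have tau0 v : v <= v1 -> (tau v = 0) * (dtau v = 0).
  move=> vv1; have [e1 e2] : v - v1 <= 0 /\ v - a <= 0 by lra.
  by rewrite /tau /dtau !ramp_le0// !smooth_ramp_le0// mulr0 subr0.
have tauL v : a + e <= v -> (tau v = c * v) * (dtau v = c).
  move=> av; have [e1 e2] : e <= v - v1 /\ e <= v - a by lra.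
  rewrite /tau /dtau !ramp_ge// !smooth_ramp_ge//; split; last by lra.
  have -> : (1 - c) * (v - a - e / 2) = (1 - c) * v - (1 - c) * (a + e / 2) by ring.
  by rewrite aE; ring.
have dtau_itv v : c - 1 <= dtau v <= 1.
  have /andP[r0 r1] := ramp_itv (v - v1) e0.
  have /andP[s0 s1] := ramp_itv (v - a) e0.
  by rewrite /dtau; apply/andP; split; nra.
have dshift (b v : R) : is_derive v 1 (fun y => smooth_ramp e (y - b)) (ramp e (v - b)).
  rewrite -[ramp e (v - b)]mulr1; apply: (@is_derive1_comp _ (smooth_ramp e)).
    exact: is_derive_smooth_ramp.
  by apply: is_derive_eq; rewrite subr0.
have dtauP (v : R) : is_derive v 1 tau (dtau v).
  have d1 := dshift v1 v; have d2 := dshift a v.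
  have -> : tau = (fun y => smooth_ramp e (y - v1)) -
    (1 - c) \*: (fun y => smooth_ramp e (y - a)) by [].
  by apply: is_derive_eq.
exists (fun v => c * v - tau v + tau (- v)), (fun v => c - dtau v - dtau (- v)).
exists (a + e) => // v; split.
- have d1 := dtauP v.
  have d2 : is_derive v 1 (tau \o -%R) (dtau (- v) * - 1) by exact: is_derive1_comp.
  have -> : (fun v => c * v - tau v + tau (- v)) =
    c \*: id - tau + (tau \o -%R) by [].
  by apply: is_derive_eq; rewrite /GRing.scale/=; ring.
- rewrite ler_norml => /andP[v1' v1''].
  by rewrite (tau0 v)// (tau0 (- v)) ?subr0//; lra.
- have := dtau_itv v; have := dtau_itv (- v).
  have [v0|v0] := leP v 0.
    by rewrite (tau0 v); [move=> /andP[? ?] _; apply/andP; lra|lra].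
  by rewrite (tau0 (- v)); [move=> _ /andP[? ?]; apply/andP; lra|lra].
- have [v0|/ltW v0] := leP 0 v; [rewrite (ger0_norm v0)|rewrite (ler0_norm v0)] => va.
    have nv : - v <= v1 by lra.
    by rewrite !(tau0 _ nv) !(tauL _ va); lra.
  have nv : v <= v1 by lra.
  by rewrite !(tau0 _ nv) !(tauL _ va); lra.
Qed.

(** For [f = - chi (W s) / gauss_pdf s], the identity
    [gauss_pdf' s = - s * gauss_pdf s] gives [f' s - s * f s = - chi' (W s)], so
    the slopes of the hat profile are exactly what the Stein inequality asks for.
    The last bound controls what the Laplacian on the sphere adds to the Stein
    operator, of size [1 / M]; it holds because [f] has compact support. *)
Lemma stein_test_function (R : realType) (C c : R) :
  0 < C -> 0 <= c -> c < 2 * Q C ->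
  exists psi f df : R -> R, exists B : R, forall s : R,
  [/\ is_derive s 1 psi (f s), is_derive s 1 f (df s),
    df s - s * f s <= (C < `|s|)%R%:R - c & s * f s - s ^+ 2 * df s <= B].
Proof.
move=> C0 c0; rewrite Q_gauss_cdf => cQ.
pose W (s : R) := gauss_cdf s - 1 / 2.
have dW (s : R) : is_derive s 1 W (gauss_pdf s).
  have ds := is_derive_gauss_cdf s.
  by rewrite /W; apply: is_derive_eq; rewrite subr0.
have WN s : W (- s) = - W s by rewrite /W gauss_cdfN; field.
have W_lt x y : x < y -> W x < W y.
  move=> xy; have [t _] := mean_value xy dW.
  by rewrite -subr_gt0 => ->; rewrite mulr_gt0 ?gauss_pdf_gt0 ?subr_gt0.
have W_le x y : x <= y -> W x <= W y.
  by rewrite le_eqVlt => /predU1P[->//|/W_lt/ltW].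
have W0 : W 0 = 0 by have := WN 0; rewrite oppr0; lra.
have W_abs s : `|W s| = W `|s|.
  have [s0|/ltW s0] := leP 0 s.
    by rewrite !ger0_norm// -W0 W_le.
  by rewrite !ler0_norm ?WN// -W0 W_le.
have WC0 : 0 < W C by rewrite -W0 W_lt.
have gC1 : gauss_cdf C < 1 by rewrite /W in WC0; nra.
have c01 : 0 <= c < 1 by rewrite c0 /=; rewrite /W in WC0; lra.
have WCc : W C < (1 - c) * 2^-1 by rewrite /W; lra.
have [chi [dchi [v2 v2L chiP]]] := hat_profile c01 WC0 WCc.
have [T WT] : exists T, v2 < W T.
  have [|T vT] := @gauss_cdf_sup R (v2 + 1 / 2); first lra.
  by exists T; rewrite /W; lra.
pose f s := - (gauss_pdf s)^-1 * chi (W s).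
pose df s := s * f s - dchi (W s).
have fP (s : R) : is_derive s 1 f (df s).
  have pdf0 : gauss_pdf s != 0 by rewrite gt_eqF// gauss_pdf_gt0.
  have d1 := is_deriveV pdf0 (is_derive_gauss_pdf s).
  have [dchis _ _ _] := chiP (W s).
  have d2 : is_derive s 1 (chi \o W) (dchi (W s) * gauss_pdf s).
    exact: is_derive1_comp.
  have -> : f = - ((fun y => (gauss_pdf y)^-1) * (chi \o W)).
    by apply/funext => y; rewrite /f /= mulNr.
  apply: is_derive_eq; rewrite /GRing.scale/= /df /f; field.
  by rewrite pdf0.
have f0 s : T <= `|s| -> f s = 0 /\ df s = 0.
  move=> Ts; have [_ _ _ []] := chiP (W s).
    by rewrite W_abs (le_trans (ltW WT))// W_le.
  by rewrite /df /f => -> ->; rewrite !mulr0 subrr.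
have cf : continuous f by move=> s; exact: is_derive_continuous (fP s).
have [psi psiP] : exists psi : R -> R, forall s : R, is_derive s 1 psi (f s).
  exists (fun y => \int[lebesgue_measure]_(t in `]-oo, y]) f t) => s.
  apply: is_derive_integralNy => //.
  have -> : EFin \o f = (EFin \o f) \_ `[- `|T|, `|T|].
    apply/funext => y; rewrite patchE; case: ifPn => // /negP yT.
    suff /f0[fy _] : T <= `|y| by rewrite /= fy.
    rewrite leNgt; apply/negP => yT'; apply: yT.
    rewrite inE /= in_itv/= -ler_norml.
    by rewrite (le_trans (ltW yT'))// ler_norm.
  apply/integrable_restrict => //=; rewrite setTI.
  apply: continuous_compact_integrable; first exact: segment_compact.
  exact: continuous_subspaceT.
have [b bP] : exists b, forall s, `|s| <= `|T| -> s * f s - s ^+ 3 * f s <= b.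
  have TT : - `|T| <= `|T| by rewrite lerNl (le_trans _ (normr_ge0 T))// lerNl oppr0.
  pose h s := s * f s - s ^+ 3 * f s.
  have hP (s : R) : is_derive s 1 h ('D_1 h s).
    have fs := fP s; apply: derivableP.
    by rewrite /h; apply: derivableB.
  have [|m _ hm] := @EVT_max _ h _ _ TT.
    by apply: continuous_subspaceT => s; exact: is_derive_continuous (hP s).
  by exists (h m) => s sT; apply: hm; rewrite in_itv/= -ler_norml.
exists psi, f, df, (`|b| + T ^+ 2) => s; split => //.
- rewrite /df; have [_ dC /andP[dge _] _] := chiP (W s).
  have [Cs|sC] := ltP; first by rewrite /=; lra.
  by rewrite dC ?W_abs ?W_le//=; lra.
- have b0 := normr_ge0 b; have T0 := sqr_ge0 T.
  have [sT|/ltW Ts] := leP `|s| `|T|; last first.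
    have [-> ->] : f s = 0 /\ df s = 0 by apply: f0; rewrite (le_trans _ Ts)// ler_norm.
    by rewrite !mulr0 subrr addr_ge0.
  have [_ _ /andP[_ d1] _] := chiP (W s).
  have -> : s * f s - s ^+ 2 * df s = (s * f s - s ^+ 3 * f s) + s ^+ 2 * dchi (W s).
    by rewrite /df; ring.
  rewrite lerD ?(le_trans (bP _ sT)) ?ler_norm//.
  rewrite (@le_trans _ _ (s ^+ 2)) ?ler_piMr ?sqr_ge0//.
  by rewrite -[s ^+ 2]real_normK ?num_real// -[T ^+ 2]real_normK ?num_real// lerXn2r ?nnegrE.
Qed.

(** * Minima on spheres *)

Lemma continuous_bigsum (T : topologicalType) (R : realType) (I : Type)
    (s : seq I) (f : I -> T -> R) :
  (forall i, continuous (f i)) -> continuous (fun x => \sum_(i <- s) f i x).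
Proof.
move=> cf; elim: s => [|i s IHs] x.
  by under eq_fun do rewrite big_nil; exact: cvg_cst.
by under eq_fun do rewrite big_cons; apply: cvgD; [exact: cf|exact: IHs].
Qed.

Definition dot (R : realType) (M : nat) (x y : 'rV[R]_M) : R :=
  \sum_i x 0 i * y 0 i.

Section DotProduct.
Context (R : realType) (M : nat).
Implicit Types (x y z : 'rV[R]_M) (a : R) (i j : 'I_M).

Lemma dotC x y : dot x y = dot y x.
Proof. by apply: eq_bigr => i _; rewrite mulrC. Qed.

Lemma dotDl x y z : dot (x + y) z = dot x z + dot y z.
Proof. by rewrite /dot -big_split; apply: eq_bigr => i _; rewrite mxE mulrDl. Qed.

Lemma dotZl a x y : dot (a *: x) y = a * dot x y.
Proof. by rewrite /dot mulr_sumr; apply: eq_bigr => i _; rewrite mxE mulrA. Qed.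

Lemma dotDr x y z : dot x (y + z) = dot x y + dot x z.
Proof. by rewrite dotC dotDl !(dotC _ x). Qed.

Lemma dotZr a x y : dot x (a *: y) = a * dot x y.
Proof. by rewrite dotC dotZl dotC. Qed.

Lemma dotNl x y : dot (- x) y = - dot x y.
Proof. by rewrite -scaleN1r dotZl mulN1r. Qed.

Lemma dot_delta i x : dot (delta_mx 0 i) x = x 0 i.
Proof.
rewrite /dot (bigD1 i)//= big1 => [|j /negPf ji]; rewrite mxE eqxx.
  by rewrite eqxx mul1r addr0.
by rewrite ji mul0r.
Qed.

Lemma dot_ge0 x : 0 <= dot x x.
Proof. by apply: sumr_ge0 => i _; rewrite -expr2 sqr_ge0. Qed.

Lemma dot_eq0 x : dot x x = 0 -> x = 0.
Proof.
move=> /eqP; rewrite psumr_eq0 => [/allP x0|i _]; last by rewrite -expr2 sqr_ge0.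
apply/rowP => i; rewrite mxE; apply/eqP.
by have := x0 i (mem_index_enum _); rewrite /= mulf_eq0 orbb.
Qed.

Lemma continuous_dotl y : continuous (fun x => dot x y).
Proof.
have cc (i : 'I_M) := @coord_continuous R 1 M 0 i.
by apply: continuous_bigsum => i x; exact: cvgM (cc i x) (cvg_cst _).
Qed.

Lemma continuous_sqnorm : continuous (fun x => dot x x).
Proof.
have cc (i : 'I_M) := @coord_continuous R 1 M 0 i.
by apply: continuous_bigsum => i x; exact: cvgM (cc i x) (cc i x).
Qed.

Lemma sphere_min (r : R) (G : 'rV[R]_M -> R) :
  (0 < M)%N -> 0 <= r -> continuous G ->
  exists2 x, dot x x = r & forall y, dot y y = r -> G x <= G y.
Proof.
move=> M0 r0 cG; pose S := [set x : 'rV[R]_M | dot x x = r].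
have S0 : S !=set0.
  exists (Num.sqrt r *: delta_mx 0 (Ordinal M0)).
  by rewrite /S /= dotZl dotC dotZl dot_delta mxE !eqxx mulr1 -expr2 sqr_sqrtr.
have closedS : closed S.
  apply: (@preimage_closed _ _ (fun x => dot x x) [set r]) => [x _|].
    exact: continuous_sqnorm.
  exact: closed_eq.
have compactS : compact S.
  apply: (subclosed_compact closedS
    (rV_compact (fun=> @segment_compact R (- (1 + r)) (1 + r)))) => x /= xr i.
  rewrite in_itv/= -ler_norml.
  have : x ord0 i ^+ 2 <= r.
    rewrite -xr /dot (bigD1 i)//= expr2 lerDl.
    by apply: sumr_ge0 => j _; rewrite -expr2 sqr_ge0.
  rewrite -[_ ^+ 2]real_normK ?num_real// => xir.
  by have := normr_ge0 (x ord0 i); nra.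
have [x xS xmin] := compact_EVT_min S0 compactS (continuous_subspaceT cG).
by exists x => [|y yS]; [rewrite inE in xS|apply: xmin; rewrite inE].
Qed.

End DotProduct.

(** The rotation by the angle [t] in the coordinate plane [(i, j)], when [i] and
    [j] differ. *)
Definition rotate (R : realType) (M : nat) (i j : 'I_M) (t : R) (x : 'rV[R]_M) :
    'rV[R]_M :=
  x + ((cos t - 1) * x 0 i - sin t * x 0 j) *: delta_mx 0 i
    + (sin t * x 0 i + (cos t - 1) * x 0 j) *: delta_mx 0 j.

Lemma dot_rotate (R : realType) (M : nat) (i j : 'I_M) (t : R) (x v : 'rV[R]_M) :
  dot (rotate i j t x) v = dot x v + (cos t - 1) * (x 0 i * v 0 i + x 0 j * v 0 j)
    + sin t * (x 0 i * v 0 j - x 0 j * v 0 i).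
Proof. by rewrite /rotate !(dotDl, dotZl) !dot_delta; ring. Qed.

Lemma sqnorm_rotate (R : realType) (M : nat) (i j : 'I_M) (t : R) (x : 'rV[R]_M) :
  i != j -> dot (rotate i j t x) (rotate i j t x) = dot x x.
Proof.
move=> ij; rewrite dot_rotate dotC dot_rotate /rotate !mxE !eqxx/= [j == i]eq_sym (negPf ij).
have /eqP := cos2Dsin2 t; rewrite eq_sym -subr_eq => /eqP/esym cos2; rewrite !mulr1n mulr0n.
by ring: cos2.
Qed.

(** Along the rotations in the plane [(i, j)], [<x, v>] moves with velocity [B]
    and acceleration [- A] at angle [0], so the right-hand side is the second
    derivative there of [\sum_n psi <x, v n>]. *)
Lemma sphere_min_rotate (R : realType) (M N : nat) (psi f df : R -> R)
    (v : 'I_N -> 'rV[R]_M) (x : 'rV[R]_M) (i j : 'I_M) :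
  (forall s : R, is_derive s 1 psi (f s)) ->
  (forall s : R, is_derive s 1 f (df s)) ->
  (forall y, dot y y = dot x x ->
    \sum_n psi (dot x (v n)) <= \sum_n psi (dot y (v n))) ->
  i != j ->
  0 <= \sum_n (df (dot x (v n)) * (x 0 i * v n 0 j - x 0 j * v n 0 i) ^+ 2
             - f (dot x (v n)) * (x 0 i * v n 0 i + x 0 j * v n 0 j)).
Proof.
move=> psif fdf xmin ij.
pose A n := x 0 i * v n 0 i + x 0 j * v n 0 j.
pose B n := x 0 i * v n 0 j - x 0 j * v n 0 i.
pose u n (t : R) := dot x (v n) + (cos t - 1) * A n + sin t * B n.
pose du n (t : R) := - sin t * A n + cos t * B n.
have uP n (t : R) : is_derive t 1 (u n) (du n t).
  have -> : u n = cst (dot x (v n) - A n) + A n \*: cos + B n \*: sin.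
    by apply/funext => y; rewrite /u !fctE /= /GRing.scale/=; ring.
  by apply: is_derive_eq; rewrite /GRing.scale/= /du; ring.
have duP n : is_derive (0 : R) 1 (du n) (- A n).
  have -> : du n = B n \*: cos - A n \*: sin.
    by apply/funext => y; rewrite /du !fctE /= /GRing.scale/=; ring.
  apply: is_derive_eq; rewrite /GRing.scale/= sin0 cos0; ring.
have u0 n : u n 0 = dot x (v n) by rewrite /u sin0 cos0; ring.
have dphi (t : R) : is_derive t 1 (\sum_n (psi \o u n)) (\sum_n f (u n t) * du n t).
  by apply: is_derive_sum => n; exact: is_derive1_comp.
have ddphi : is_derive (0 : R) 1 (\sum_n ((f \o u n) * du n))
    (\sum_n (df (dot x (v n)) * B n ^+ 2 - f (dot x (v n)) * A n)).
  apply: is_derive_sum => n.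
  have d1 : is_derive (0 : R) 1 (f \o u n) (df (u n 0) * du n 0).
    exact: is_derive1_comp.
  have d2 := duP n.
  apply: is_derive_eq; rewrite /GRing.scale/= u0 /du sin0 cos0; ring.
have ddphi' : is_derive (0 : R) 1 (fun t => \sum_n f (u n t) * du n t)
    (\sum_n (df (dot x (v n)) * B n ^+ 2 - f (dot x (v n)) * A n)).
  suff -> : (fun t => \sum_n f (u n t) * du n t) = \sum_n ((f \o u n) * du n) by [].
  by apply/funext => t; rewrite fct_sumE.
apply: (second_derivative_test dphi ddphi') => t.
rewrite !fct_sumE; under eq_bigr do rewrite /= u0.
have := xmin _ (sqnorm_rotate t x ij); congr (_ <= _).
by apply: eq_bigr => n _; rewrite dot_rotate.
Qed.

(** Lagrange's identity. *)
Lemma sum_rotation_sqr (R : realType) (M : nat) (x v : 'rV[R]_M) :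
  \sum_i \sum_j (x 0 i * v 0 j - x 0 j * v 0 i) ^+ 2 =
  2 * (dot x x * dot v v - dot x v ^+ 2).
Proof.
have -> : 2 * (dot x x * dot v v - dot x v ^+ 2) =
    dot x x * dot v v + dot v v * dot x x - 2 * (dot x v * dot x v) by ring.
rewrite /dot !big_distrlr/= mulr_sumr -!big_split/= -sumrB.
apply: eq_bigr => i _; rewrite mulr_sumr -!big_split/= -sumrB.
by apply: eq_bigr => j _; ring.
Qed.

Lemma sum_rotation_dot (R : realType) (M : nat) (x v : 'rV[R]_M) :
  \sum_i \sum_j (x 0 i * v 0 i + x 0 j * v 0 j) = 2 * M%:R * dot x v.
Proof.
under eq_bigr do rewrite big_split/= sumr_const card_ord.
rewrite big_split/= sumr_const card_ord sumrMnl -/(dot x v).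
by rewrite -mulr2n -mulrnA -[LHS]mulr_natl natrM [M%:R * _]mulrC.
Qed.

(** The Laplacian of a sphere is the sum, over all coordinate planes, of the
    squares of the infinitesimal rotations; this expresses it in the ambient
    coordinates, without a basis of the tangent space. *)
Lemma sphere_laplacian (R : realType) (M N : nat) (psi f df : R -> R) (r : R)
    (v : 'I_N -> 'rV[R]_M) :
  (forall s : R, is_derive s 1 psi (f s)) ->
  (forall s : R, is_derive s 1 f (df s)) ->
  (0 < M)%N -> 0 <= r -> (forall n, dot (v n) (v n) = 1) ->
  exists2 x, dot x x = r &
    0 <= \sum_n (df (dot x (v n)) * (r - dot x (v n) ^+ 2)
               - (M%:R - 1) * (dot x (v n) * f (dot x (v n)))).
Proof.
move=> psif fdf M0 r0 v1.
have cG : continuous (fun x => \sum_n psi (dot x (v n))).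
  apply: continuous_bigsum => n x; apply: continuous_comp.
    exact: continuous_dotl.
  exact: is_derive_continuous (psif _).
have [x xr xmin] := sphere_min M0 r0 cG.
exists x => //; rewrite -xr in xmin *.
pose E i j n := df (dot x (v n)) * (x 0 i * v n 0 j - x 0 j * v n 0 i) ^+ 2
             - f (dot x (v n)) * (x 0 i * v n 0 i + x 0 j * v n 0 j).
have E0 : 0 <= \sum_i \sum_(j | j != i) \sum_n E i j n.
  apply: sumr_ge0 => i _; apply: sumr_ge0 => j ji.
  by apply: sphere_min_rotate => //; rewrite eq_sym.
(* Each plane is counted twice, as [(i, j)] and as [(j, i)]. *)
suff EE : \sum_i \sum_(j | j != i) \sum_n E i j n =
    2 * \sum_n (df (dot x (v n)) * (dot x x - dot x (v n) ^+ 2)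
             - (M%:R - 1) * (dot x (v n) * f (dot x (v n)))).
  by move: E0; rewrite EE pmulr_rge0.
have -> : \sum_i \sum_(j | j != i) \sum_n E i j n =
    \sum_n (\sum_i \sum_j E i j n - \sum_i E i i n).
  rewrite sumrB [X in _ = X - _]exchange_big [X in _ = _ - X]exchange_big/=.
  rewrite -sumrB; apply: eq_bigr => i _.
  by rewrite [X in _ = X - _]exchange_big [X in X - _](bigD1 i)//=
    addrAC subrr add0r.
rewrite mulr_sumr; apply: eq_bigr => n _.
have -> : \sum_i E i i n = - (f (dot x (v n)) * (2 * dot x (v n))).
  by rewrite /E /dot !mulr_sumr -sumrN; apply: eq_bigr => i _; ring.
have -> : \sum_i \sum_j E i j n =
    df (dot x (v n)) * (2 * (dot x x * 1 - dot x (v n) ^+ 2))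
    - f (dot x (v n)) * (2 * M%:R * dot x (v n)).
  rewrite -{2}(v1 n) -sum_rotation_sqr -sum_rotation_dot !mulr_sumr -sumrB.
  by apply: eq_bigr => i _; rewrite !mulr_sumr -sumrB.
ring.
Qed.

(** Divided by [M], the inequality of [sphere_laplacian] on the sphere of radius
    [sqrt M] reads [0 <= \sum_n (df s - s f s + (s f s - s^2 df s) / M)]. *)
Lemma sphere_large_dot (R : realType) (C c : R) :
  0 < C -> 0 <= c -> c < 2 * Q C ->
  exists B : R, forall (M N : nat) (v : 'I_N -> 'rV[R]_M), (0 < M)%N ->
    (forall n, dot (v n) (v n) = 1) ->
  exists2 x : 'rV[R]_M, dot x x = M%:R &
    (c * M%:R - B) * N%:R <= M%:R * #|[pred n | C < `|dot x (v n)|]|%:R.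
Proof.
move=> C0 c0 cQ; have [psi [f [df [B psiB]]]] := stein_test_function C0 c0 cQ.
exists B => M N v M0 v1.
have [||x xM lap] :=
  @sphere_laplacian R M N psi f df M%:R v _ _ M0 (ler0n _ _) v1.
- by move=> s; case: (psiB s).
- by move=> s; case: (psiB s).
exists x => //.
have -> : #|[pred n | C < `|dot x (v n)|]|%:R =
    \sum_n (C < `|dot x (v n)|)%R%:R :> R.
  rewrite -sum1_card natr_sum big_mkcond/=; apply: eq_bigr => n _.
  by rewrite inE; case: ifP.
rewrite -subr_ge0; apply: (le_trans lap).
have -> : (c * M%:R - B) * N%:R = \sum_(n < N) (c * M%:R - B).
  by rewrite sumr_const card_ord mulr_natr.
rewrite mulr_sumr -sumrB; apply: ler_sum => n _.
have [_ _ h1 h2] := psiB (dot x (v n)).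
have := ler_wpM2l (ler0n R M) h1.
lra.
Qed.

(** * Extreme eigenvalues and the condition number *)

Lemma dot_mulmx (R : realType) (M : nat) (x y : 'rV[R]_M) :
  (x *m y^T) 0 0 = dot x y.
Proof. by rewrite mxE; apply: eq_bigr => i _; rewrite mxE. Qed.

Lemma dot_mul_trmx (R : realType) (M K : nat) (A : 'M[R]_(M, K))
    (x : 'rV[R]_M) (y : 'rV[R]_K) : dot x (y *m A^T) = dot (x *m A) y.
Proof. by rewrite -!dot_mulmx trmx_mul trmxK mulmxA. Qed.

Section SymmetricSpectrum.
Context (R : realType) (M : nat) (M0 : (0 < M)%N).
Implicit Type S : 'M[R]_M.

Lemma eigenvalue_rayleigh S a : eigenvalue S a ->
  exists2 x, 0 < dot x x & dot (x *m S) x = a * dot x x.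
Proof.
move=> /eigenvalueP[x xS x0]; exists x; last by rewrite xS dotZl.
rewrite lt_neqAle dot_ge0 andbT eq_sym.
by apply: contra x0 => /eqP/dot_eq0 ->.
Qed.

(** The minimum [a] of the Rayleigh quotient is attained at some [x], and the
    quadratic form [S - a] is nonnegative and vanishes at [x]; hence [x] lies in
    its kernel. *)
Lemma exists_min_eigenvalue S : S^T = S ->
  exists2 a, eigenvalue S a & forall x, a * dot x x <= dot (x *m S) x.
Proof.
move=> Ssym.
have cq : continuous (fun x : 'rV[R]_M => dot (x *m S) x).
  apply: continuous_bigsum => i x.
  have -> : (fun x : 'rV[R]_M => (x *m S) 0 i * x 0 i) =
      (fun x => dot x (row i S) * x 0 i).
    apply/funext => y; congr (_ * _); rewrite mxE; apply: eq_bigr => k _.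
    by rewrite -[in LHS]Ssym !mxE.
  exact: cvgM (@continuous_dotl R M _ x) (@coord_continuous R 1 M 0 i x).
have [x x1 xmin] := sphere_min M0 ler01 cq.
set a := dot (x *m S) x in xmin.
have amin y : a * dot y y <= dot (y *m S) y.
  have [/dot_eq0 ->|y0] := eqVneq (dot y y) 0.
    by rewrite mul0mx /dot !big1 ?mulr0// => i _; rewrite mxE mul0r.
  have yy : 0 < dot y y by rewrite lt_neqAle dot_ge0 eq_sym y0.
  have sy : Num.sqrt (dot y y) != 0 by rewrite gt_eqF// sqrtr_gt0.
  have sE := sqr_sqrtr (ltW yy).
  have := xmin ((Num.sqrt (dot y y))^-1 *: y).
  rewrite -scalemxAl !(dotZl, dotZr).
  rewrite !mulrA -expr2 exprVn sE mulVf// => /(_ erefl).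
  by rewrite mulrC ler_pdivlMr.
exists a => //; apply/eigenvalueP; exists x; last first.
  by apply/eqP => x0; move: x1; rewrite x0 /dot big1 => [/eqP|i _];
    rewrite ?mxE ?mul0r// eq_sym oner_eq0.
have [y yS] : exists y, y = x *m S - a *: x by eexists.
apply/eqP; rewrite -subr_eq0 -yS; apply/eqP/dot_eq0.
have symS u v : dot (u *m S) v = dot u (v *m S) by rewrite -dot_mul_trmx Ssym.
have yE : dot (x *m S) y - a * dot x y = dot y y.
  have -> : dot y y = dot (x *m S - a *: x) y by rewrite -yS.
  by rewrite dotDl dotNl dotZl.
set w := dot (y *m S) y - a * dot y y.
have quad t : 0 <= t * (2 * dot y y + t * w).
  have := amin (x + t *: y); rewrite -subr_ge0; congr (_ <= _).
  rewrite mulmxDl -scalemxAl !(dotDl, dotZl, dotDr, dotZr) (symS y x).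
  by rewrite (dotC y (x *m S)) (dotC y x) -/a x1 /w -yE; ring.
have yy := dot_ge0 y.
(* The quadratic polynomial of [quad] has its minimum at [- dot y y / w] if
   [0 < w]; otherwise [t = -1] bounds [dot y y]. *)
have [w0|w0] := ltP 0 w.
  have := quad (- (dot y y / w)); rewrite mulNr mulNr divfK ?gt_eqF//.
  have := divr_ge0 yy (ltW w0).
  have : dot y y / w * w = dot y y by rewrite divfK ?gt_eqF.
  nra.
by have := quad (-1); lra.
Qed.

Lemma lambda_min_rayleigh S : S^T = S -> eigenvalue S (lambda_min S) /\
  forall x, lambda_min S * dot x x <= dot (x *m S) x.
Proof.
move=> /exists_min_eigenvalue[a Sa amin].
suff -> : lambda_min S = a by [].
have lb : lbound [set b | eigenvalue S b] a.
  move=> b /eigenvalue_rayleigh[x x0 xb].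
  by rewrite -(ler_pM2r x0) -xb amin.
apply/eqP; rewrite eq_le; apply/andP; split.
  by apply: ge_inf => //; exists a.
by apply: lb_le_inf => //; exists a.
Qed.

Lemma lambda_maxN S : lambda_max S = - lambda_min (- S).
Proof.
rewrite /lambda_max /lambda_min /inf opprK; congr sup.
apply/seteqP; split=> a /=.
  move=> /eigenvalueP[x xS x0]; exists (- a); last by rewrite opprK.
  by apply/eigenvalueP; exists x => //; rewrite mulmxN xS scaleNr.
move=> [b /eigenvalueP[x xS x0] <-].
by apply/eigenvalueP; exists x => //; rewrite -[S]opprK mulmxN xS scaleNr.
Qed.

Lemma lambda_max_rayleigh S x : S^T = S ->
  dot (x *m S) x <= lambda_max S * dot x x.
Proof.
move=> Ssym; rewrite lambda_maxN mulNr lerNr -dotNl -mulmxN.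
by apply: (lambda_min_rayleigh _).2; rewrite linearN/= Ssym.
Qed.

(** Each diagonal entry of [S] is a Rayleigh quotient. *)
Lemma lambda_min_trace S : S^T = S -> M%:R * lambda_min S <= \tr S.
Proof.
move=> Ssym; rewrite /mxtrace mulr_natl -[M in _ *+ M]card_ord -sumr_const.
apply: ler_sum => i _.
have := (lambda_min_rayleigh Ssym).2 (delta_mx 0 i).
by rewrite -rowE dot_delta dotC dot_delta !mxE !eqxx mulr1.
Qed.

End SymmetricSpectrum.

(** The greatest eigenvalue is compared with the Rayleigh quotient at [x], and
    the least one with the mean of the diagonal. *)
Lemma Cond_gt (R : realType) (M K : nat) (A : 'M[R]_(M, K)) (C : R)
    (x : 'rV[R]_M) :
  (0 < M)%N -> 0 <= C ->
  C ^+ 2 * \tr (A *m A^T) * dot x x < M%:R * dot (x *m A) (x *m A) ->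
  (C%:E < Cond A)%E.
Proof.
move=> M0 C0 xA; rewrite /Cond; case: ltnP => [_|rA]; first exact: ltry.
set S := A *m A^T in xA *.
have Ssym : S^T = S by rewrite trmx_mul trmxK.
have qS y : dot (y *m S) y = dot (y *m A) (y *m A).
  by rewrite mulmxA dotC dot_mul_trmx.
have [/(eigenvalue_rayleigh)[y y0 yl] _] := lambda_min_rayleigh M0 Ssym.
have l0 : 0 < lambda_min S.
  rewrite -(pmulr_lgt0 _ y0) -yl qS lt_neqAle dot_ge0 andbT eq_sym.
  apply: contraTneq y0 => /dot_eq0 yA.
  have -> : y = 0.
    have /row_free_inj Ainj : row_free A.
      by rewrite /row_free eqn_leq rank_leq_row.
    by apply: Ainj; rewrite mul0mx.
  by rewrite /dot big1 ?ltxx// => i _; rewrite mxE mul0r.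
have x0 : 0 < dot x x.
  rewrite lt_neqAle dot_ge0 andbT eq_sym; apply: contraTneq xA => /dot_eq0 ->.
  by rewrite mul0mx /dot !big1 ?mulr0 ?ltxx// => i _; rewrite mxE mul0r.
have tr_max : C ^+ 2 * \tr S < M%:R * lambda_max S.
  rewrite -(ltr_pM2r x0) (lt_le_trans xA)// -mulrA ler_wpM2l// -qS.
  exact: lambda_max_rayleigh.
rewrite lte_fin -[ltLHS](ger0_norm C0) -sqrtr_sqr ltr_sqrt; last first.
  apply: divr_gt0 => //; rewrite -(pmulr_rgt0 _ (_ : 0 < M%:R)) ?ltr0n//.
  apply: le_lt_trans tr_max; rewrite mulr_ge0 ?sqr_ge0//.
  by apply: le_trans (lambda_min_trace M0 Ssym); rewrite mulr_ge0// ltW.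
rewrite ltr_pdivlMr// -(@ltr_pM2l _ M%:R) ?ltr0n//.
apply: le_lt_trans tr_max; rewrite mulrCA ler_wpM2l ?sqr_ge0//.
exact: lambda_min_trace.
Qed.

(** * Numerically erasure-robust frames *)

Lemma exists_subset_card (T : finType) (S : {pred T}) (k : nat) :
  (k <= #|S|)%N -> exists2 K : {set T}, K \subset S & #|K| = k.
Proof.
move=> kS; exists [set x in take k (enum S)].
  by apply/fintype.subsetP => x; rewrite inE => /mem_take; rewrite mem_enum.
rewrite cardsE; have /card_uniqP -> := take_uniq k (enum_uniq S).
by rewrite size_takel// -cardE.
Qed.

(** A zero vector gets an arbitrary direction, so that zero columns need no
    separate count. *)
Lemma exists_direction (R : realType) (M : nat) (f : 'rV[R]_M) : (0 < M)%N ->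
  exists av : R * 'rV[R]_M, f = av.1 *: av.2 /\ dot av.2 av.2 = 1.
Proof.
move=> M0; have [->|f0] := eqVneq f 0.
  exists (0, delta_mx 0 (Ordinal M0)).
  by rewrite scale0r dot_delta mxE !eqxx.
have ff : 0 < dot f f.
  rewrite lt_neqAle dot_ge0 andbT eq_sym.
  by apply: contra f0 => /eqP/dot_eq0 ->.
have sf : Num.sqrt (dot f f) != 0 by rewrite gt_eqF// sqrtr_gt0.
exists (Num.sqrt (dot f f), (Num.sqrt (dot f f))^-1 *: f) => /=.
rewrite scalerA divff// scale1r dotZl dotZr -{3}(sqr_sqrtr (ltW ff)).
by split => //; field.
Qed.

Lemma Cond_col_restrict_gt (R : realType) (M N : nat) (F : 'M[R]_(M, N)) (C : R)
    (a : 'I_N -> R) (v : 'I_N -> 'rV[R]_M) (x : 'rV[R]_M) (K : {set 'I_N}) :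
  (0 < M)%N -> 0 <= C -> dot x x = M%:R ->
  (forall n, (col n F)^T = a n *: v n) -> (forall n, dot (v n) (v n) = 1) ->
  (forall n, n \in K -> C < `|dot x (v n)|) ->
  (C%:E < Cond (col_restrict F K))%E.
Proof.
move=> M0 C0 xM Fav v1 xK; set A := col_restrict F K.
(* If [A] is not zero, some [a n] is not, and the inequality below is strict. *)
have [A0|A0] := eqVneq A 0; first by rewrite A0 /Cond mxrank0 M0 ltry.
have AE i k : A i k = a (enum_val k) * v (enum_val k) 0 i.
  by have /rowP/(_ i) := Fav (enum_val k); rewrite !mxE.
apply: (Cond_gt (x := x)) => //; rewrite xM mulrC ltr_pM2l ?ltr0n//.
have -> : \tr (A *m A^T) = \sum_(k < #|K|) a (enum_val k) ^+ 2.
  rewrite /mxtrace; under eq_bigr do rewrite mxE.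
  rewrite exchange_big/=; apply: eq_bigr => k _.
  rewrite -[RHS]mulr1 -(v1 (enum_val k)) /dot mulr_sumr.
  by apply: eq_bigr => i _; rewrite [A^T _ _]mxE AE; ring.
have -> : dot (x *m A) (x *m A) =
    \sum_(k < #|K|) a (enum_val k) ^+ 2 * dot x (v (enum_val k)) ^+ 2.
  apply: eq_bigr => k _; rewrite -expr2 -exprMn; congr (_ ^+ 2).
  by rewrite mxE /dot mulr_sumr; apply: eq_bigr => i _; rewrite AE; ring.
have C2 (k : 'I_#|K|) : C ^+ 2 < dot x (v (enum_val k)) ^+ 2.
  rewrite -[ltRHS]real_normK ?num_real// ltrXn2r ?nnegrE//.
  by rewrite xK// enum_valP.
have term_ge0 (k : 'I_#|K|) : true ->
    0 <= a (enum_val k) ^+ 2 * (dot x (v (enum_val k)) ^+ 2 - C ^+ 2).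
  by move=> _; rewrite mulr_ge0 ?sqr_ge0// subr_ge0 ltW.
rewrite mulr_sumr -subr_gt0 -sumrB.
under eq_bigr do rewrite [C ^+ 2 * _]mulrC -mulrBr.
rewrite lt_neqAle sumr_ge0// andbT eq_sym; apply: contra A0.
rewrite psumr_eq0// => /allP all0; apply/eqP/matrixP => i k.
have := all0 k (mem_index_enum _); rewrite /= mulf_eq0 sqrf_eq0 subr_eq0.
by rewrite (gt_eqF (C2 k)) orbF AE mxE => /eqP ->; rewrite mul0r.
Qed.

Lemma limn_inf_gt (R : realType) (u : nat -> R) (a : R) :
  bounded_fun u -> a < limn_inf u -> \forall n \near \oo, a < u n.
Proof.
move=> ub; rewrite limn_infE// => /(sup_gt _)[].
  by exists (infs u 0), 0.
move=> _ [n _ <-] an; exists n => // m /= nm; apply: (lt_le_trans an).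
apply: ge_inf; last by exists m.
exact/has_lbound_sdrop/bounded_fun_has_lbound.
Qed.

Theorem theorem11 (R : realType) (N : nat -> nat)
    (F : forall M : nat, 'M[R]_(M, N M)) (C : R) (p : nat -> R)
    (hF : forall M : nat, (0 < M)%N -> is_frame (F M))
    (hC : 1 < C)
    (hp : forall M : nat, (0 < M)%N -> 0 <= p M <= 1)
    (hpN : forall M : nat, (0 < M)%N -> (1 - p M) * (N M)%:R \is a Num.int)
    (hliminf : 1 - 2 * Q C < limn_inf p) :
  \forall M \near \oo, ~ is_NERF (p M) C (F M).
Proof.
have C0 : 0 < C by rewrite (lt_trans ltr01).
(* Eventually [a < p M].  The density lemma is used with [1 - a + d], which is
   still less than [2 * Q C]; the margin [d] absorbs its error term [B / M]. *)
pose d := (limn_inf p - (1 - 2 * Q C)) / 3.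
pose a := 1 - 2 * Q C + 2 * d.
have d0 : 0 < d by rewrite /d; lra.
have pbnd : bounded_fun p.
  exists (1 + `|p 0%N|); split; first exact: num_real.
  move=> y y1 n _ /=; apply: (le_trans _ (ltW y1)).
  case: n => [|n]; first by rewrite lerDr.
  have /andP[p0 p1] := hp n.+1 isT.
  by rewrite ger0_norm// (le_trans p1)// lerDl.
have pa : \forall n \near \oo, a < p n.
  by apply: limn_inf_gt => //; rewrite /a /d; lra.
have a1 : a < 1.
  case: pa => n _ /(_ n.+1 (leqnSn n)) /= /lt_le_trans; apply.
  by have /andP[] := hp n.+1 isT.
have [||B large] := @sphere_large_dot R C (1 - a + d) C0; first by lra.
  by rewrite /a; lra.
near=> M.
have M0 : (0 < M)%N by near: M; exists 1%N.
have Md : B <= d * M%:R.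
  rewrite mulrC -ler_pdivrMr//; near: M.
  by apply: nbhs_infty_ger.
have paM : a < p M by near: M.
have /andP[p0 p1] := hp M M0.
have [av avP] := choice (fun n => exists_direction (col n (F M))^T M0).
have [n|x xM xlarge] := large M (N M) (fun n => (av n).2) M0;
  first by case: (avP n).
have MR : 0 < M%:R :> R by rewrite ltr0n.
have /natrP[k kE] : (1 - p M) * (N M)%:R \is a Num.nat.
  by rewrite natrEint hpN// mulr_ge0// subr_ge0.
have kS : (k <= #|[pred n | (C < `|dot x (av n).2|)%R]|)%N.
  rewrite -(ler_nat R) -kE -(ler_pM2l MR); apply: le_trans xlarge.
  rewrite mulrA ler_wpM2r//.
  have : (1 - p M) * M%:R <= (1 - a) * M%:R by rewrite ler_wpM2r//; lra.
  lra.
have [K KS Kk] := exists_subset_card kS.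
have KE : #|K|%:R = (1 - p M) * (N M)%:R by rewrite Kk kE.
move=> /(_ K KE); rewrite leNgt => /negP; apply.
apply: (Cond_col_restrict_gt M0 (ltW C0) xM (fun n => (avP n).1)) => n.
  by case: (avP n).
by move=> /(fintype.subsetP KS); rewrite inE.
Unshelve. all: by end_near. Qed.
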